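(* For $n\ge2$, $$\widetilde B_n(t_0,\dots,t_n)=\sum_{u\in S_n}b_1(u)\cdots b_n(u),$$ where, with the convention $u_0=0$, $$b_i(u):=t_i^{\chi(u_{i-1}<u_i)}+t_{i+1}^{\chi(u_i>u_{i+1})}\quad\text{for }1\le i<n-1,$$ $$b_{n-1}(u):=t_{n-1}^{\chi(u_{n-2}<u_{n-1})}+(t_0t_n)^{\chi(u_{n-1}>u_n)},$$ $$b_n(u):=t_n^{\chi(u_{n-1}<u_n)}+t_0^{\chi(u_{n-1}<u_n)}.$$
   Context: $S_n$ is the symmetric group on $\{1,\dots,n\}$, with permutations written $u=u_1\cdots u_n$. $\chi(S)=1$ if the statement $S$ is true and $0$ if it is false. The Weyl group $B_n$ is the group of signed permutations: permutations $w$ of $\{\pm1,\dots,\pm n\}$ with $w(-i)=-w(i)$, written $w=w_1\cdots w_n$ with $w_i=w(i)$. The simple roots are $\alpha_1=\varepsilon_1$, $\alpha_i=\varepsilon_i-\varepsilon_{i-1}$ ($2\le i\le n$), and the lowest root is $\alpha_0=-\varepsilon_{n-1}-\varepsilon_n$. The affine descent set $\widetilde{\mathrm{Des}}(w)\subseteq\{0,1,\dots,n\}$ of $w\in B_n$ consists of all $i\in\{1,\dots,n\}$ with $w_{i-1}>w_i$ (convention $w_0=0$), together with $0$ if $w_{n-1}+w_n>0$. The multivariate affine Eulerian polynomial is $\widetilde B_n(t_0,\dots,t_n)=\sum_{w\in B_n}\prod_{i\in\widetilde{\mathrm{Des}}(w)}t_i$. *)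

(* Defs.v *)
From mathcomp Require Import all_boot all_order all_fingroup all_algebra.
From mathcomp Require Import mpoly.

Set Implicit Arguments.
Unset Strict Implicit.
Unset Printing Implicit Defensive.

Import Order.TTheory GRing.Theory Num.Theory.

Local Open Scope ring_scope.

(* The set {-n, ..., -1, 1, ..., n}: the pair (s, k) encodes the integer
   k + 1 if s = false, and - (k + 1) if s = true. *)
Definition signed (n : nat) : finType := (bool * 'I_n)%type.

Definition signed_int (n : nat) (x : signed n) : int :=
  (-1) ^+ x.1 * (x.2.+1)%:Z.

Definition signed_opp (n : nat) (x : signed n) : signed n := (~~ x.1, x.2).

Lemma signed_intN n (x : signed n) :
  signed_int (signed_opp x) = - signed_int x.
Proof. by case: x => [[] i]; rewrite /signed_int /= !expr1 ?expr0 !mulNr ?opprK. Qed.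

Lemma signed_int_inj n : injective (@signed_int n).
Proof.
case=> [[] i] [[] j]; rewrite /signed_int /= ?expr1 ?expr0 ?mulN1r ?mul1r //.
  by move/oppr_inj=> [] /ord_inj ->.
by case=> /ord_inj ->.
Qed.

Definition weylB (n : nat) : {set {perm (signed n)}} :=
  [set w : {perm (signed n)} |
    [forall x, w (signed_opp x) == signed_opp (w x)]].

Lemma weylB_group_set n : group_set (weylB n).
Proof.
apply/group_setP; split=> [|v w].
  by rewrite inE; apply/forallP=> x; rewrite !perm1.
rewrite !inE => /forallP Hv /forallP Hw; apply/forallP=> x.
by rewrite !permM (eqP (Hv x)) (eqP (Hw _)).
Qed.

Canonical weylB_group n := Group (weylB_group_set n).

(* The letter w_i = w(i) for 1 <= i <= n, with w_0 = 0; the positive integer i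
   is encoded as (false, i - 1).  The value for i > n is the junk value 0. *)
Definition letterB (n : nat) (w : {perm (signed n)}) (i : nat) : int :=
  if i is k.+1 then
    if insub k is Some j then signed_int (w (false, j : 'I_n)) else 0
  else 0.

Definition affDes (n : nat) (w : {perm (signed n)}) : {set 'I_n.+1} :=
  [set i : 'I_n.+1 |
    if i == 0%N :> nat then 0 < letterB w n.-1 + letterB w n
    else letterB w i < letterB w i.-1].

(* The variables t_0, ..., t_n are the n + 1 indeterminates 'X_i, i : 'I_n.+1. *)
Definition affEulerB (n : nat) : {mpoly int[n.+1]} :=
  \sum_(w in weylB n) \prod_(i in affDes w) 'X_i.

(* The letter u_i, in {1, ..., n}, of a permutation u of {1, ..., n}, with
   u_0 = 0; 'S_n permutes {0, ..., n - 1}, hence the shifts by one.  The value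
   for i > n is the junk value 0. *)
Definition letterS (n : nat) (u : 'S_n) (i : nat) : nat :=
  if i is k.+1 then
    if insub k is Some j then (u (j : 'I_n)).+1 else 0%N
  else 0%N.

(* For 1 <= i <= n.  The boolean exponents are coerced to 0 or 1, which is
   the function chi. *)
Definition bfactor (n : nat) (u : 'S_n) (i : nat) : {mpoly int[n.+1]} :=
  let t (k : nat) : {mpoly int[n.+1]} := 'X_(inord k : 'I_n.+1) in
  let u_ := letterS u in
  if (i < n.-1)%N then
    t i ^+ (u_ i.-1 < u_ i)%N + t i.+1 ^+ (u_ i.+1 < u_ i)%N
  else if i == n.-1 then
    t n.-1 ^+ (u_ n.-2 < u_ n.-1)%N + (t 0%N * t n) ^+ (u_ n < u_ n.-1)%N
  else
    t n ^+ (u_ n.-1 < u_ n)%N + t 0%N ^+ (u_ n.-1 < u_ n)%N.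

(* Main.v *)
(** A signed permutation is an ordinary permutation [u] of absolute values
    together with a choice of signs.  For unequal absolute values, whether
    [w_{i-1} > w_i] or [w_{n-1} + w_n > 0] holds depends only on the sign of
    whichever of the two letters is larger in absolute value.  So, for fixed
    [u], each descent is decided by the sign of a single letter, the monomial
    of [w] is a product over letters of terms depending only on the sign of
    that letter, and the sum over all signs factors as a product of binomials. *)

Require Import Defs.
From mathcomp Require Import all_boot all_order all_fingroup all_algebra.
From mathcomp Require Import mpoly.
From mathcomp Require Import zify ring.

Set Implicit Arguments.
Unset Strict Implicit.
Unset Printing Implicit Defensive.

Import Order.TTheory GRing.Theory Num.Theory.

Local Open Scope ring_scope.

Section SignedPermutations.
Variable n : nat.

(** Signs are indexed by positions, not by absolute values, to match the factors [bfactor u i]. *)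
Definition signed_act (u : 'S_n) (s : {ffun 'I_n -> bool}) (x : signed n) :
  signed n := (x.1 (+) s x.2, u x.2).

Lemma signed_act_inj u s : injective (signed_act u s).
Proof.
case=> a i [b j] [] /= eqab /perm_inj eqij; rewrite -eqij in eqab *.
by rewrite (addIb eqab).
Qed.

Definition signed_perm (p : 'S_n * {ffun 'I_n -> bool}) : {perm (signed n)} :=
  perm (@signed_act_inj p.1 p.2).

Lemma signed_perm_inj : injective signed_perm.
Proof.
case=> u s [v r] /permP eq_us; congr (_, _).
  by apply/permP=> k; have := eq_us (false, k); rewrite !permE => -[].
by apply/ffunP=> k; have := eq_us (false, k); rewrite !permE => -[].
Qed.

Lemma weylB_signed_perm : weylB n = signed_perm @: setT.
Proof.
apply/setP=> w; apply/idP/imsetP=> [|[[u s] _ ->]]; last first.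
  rewrite inE; apply/forallP=> -[b k]; rewrite !permE /signed_act /signed_opp /=.
  by rewrite addNb.
rewrite inE => /forallP wN.
have absw_inj : injective (fun k => (w (false, k)).2).
  move=> j k /= eqjk; have /eqP wNk := wN (false, k).
  have [eq1|neq1] := eqVneq (w (false, j)).1 (w (false, k)).1.
    have : w (false, j) = w (false, k).
      by rewrite [LHS]surjective_pairing eq1 eqjk -surjective_pairing.
    by move/perm_inj => [].
  (* Equal absolute values with opposite signs would, by oddness, identify a positive argument with
     a negative one. *)
  have : w (false, j) = w (signed_opp (false, k)).
    rewrite wNk [LHS]surjective_pairing eqjk /signed_opp; congr (_, _).
    by move: neq1; case: (_.1); case: (_.1).
  by move/perm_inj.
exists (perm absw_inj, [ffun k => (w (false, k)).1]) => //.
apply/permP=> -[b k]; rewrite permE /signed_act /= permE ffunE.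
case: b => /=; last by rewrite -surjective_pairing.
by rewrite (eqP (wN (false, k))).
Qed.

(** Since [0.-1 = 0], index 0 reads the sign of the first letter; this is harmless because the
    letter at 0 is zero. *)
Definition sign_at (s : {ffun 'I_n -> bool}) (i : nat) : bool :=
  if insub i.-1 is Some k then s k else false.

Lemma letterB_signed_perm u s i :
  letterB (signed_perm (u, s)) i = (-1) ^+ sign_at s i * (letterS u i)%:Z.
Proof.
case: i => [|i] /=; first by rewrite mulr0.
rewrite /sign_at /=; case: insubP => [k _ _|_]; last by rewrite mulr0.
by rewrite permE.
Qed.

Lemma letterS_neq (u : 'S_n) i :
  (0 < i <= n)%N -> letterS u i.-1 != letterS u i.
Proof.
case: i => [//|i] /= ltin; rewrite (insubT (fun k => (k < n)%N) ltin) /=.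
case: i ltin => [//|i] ltin /=.
rewrite (insubT (fun k => (k < n)%N) (ltnW ltin)) eqSS.
by apply/eqP=> /ord_inj/perm_inj/(congr1 val)/= /eqP; rewrite ltn_eqF.
Qed.

End SignedPermutations.

Lemma ltr_signed (d e : bool) (v u : nat) : v != u ->
  ((-1) ^+ e * u%:Z < (-1) ^+ d * v%:Z :> int) =
  (e && (v < u)%N || ~~ d && (u < v)%N).
Proof. by case: d e => -[]; rewrite /= ?expr1 ?expr0; lia. Qed.

Lemma addr_signed_gt0 (d e : bool) (v u : nat) : v != u ->
  (0 < (-1) ^+ d * v%:Z + (-1) ^+ e * u%:Z :> int) =
  (~~ d && (u < v)%N || ~~ e && (v < u)%N).
Proof. by case: d e => -[]; rewrite /= ?expr1 ?expr0; lia. Qed.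

(** Splits a descent indicator into two powers, each governed by the sign of one letter. *)
Lemma expr_orb (R : pzSemiRingType) (x : R) (a b : bool) :
  ~~ (a && b) -> x ^+ (a || b) = x ^+ a * x ^+ b.
Proof. by case: a b => -[]; rewrite ?expr0 ?mul1r ?mulr1. Qed.

(** The summand of [bfactor u i] selected by the sign of letter [i], with [true] for negative. *)
Definition sign_factor n (u : 'S_n) (i : nat) (e : bool) : {mpoly int[n.+1]} :=
  let t (k : nat) : {mpoly int[n.+1]} := 'X_(inord k : 'I_n.+1) in
  let u_ := letterS u in
  if (i < n.-1)%N then
    if e then t i ^+ (u_ i.-1 < u_ i)%N else t i.+1 ^+ (u_ i.+1 < u_ i)%N
  else if i == n.-1 then
    if e then t n.-1 ^+ (u_ n.-2 < u_ n.-1)%N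
    else (t 0%N * t n) ^+ (u_ n < u_ n.-1)%N
  else if e then t n ^+ (u_ n.-1 < u_ n)%N else t 0%N ^+ (u_ n.-1 < u_ n)%N.

Lemma bfactorE n (u : 'S_n) i : bfactor u i = \sum_(e : bool) sign_factor u i e.
Proof. by rewrite big_bool /bfactor /sign_factor; case: ifP => // _; case: ifP. Qed.

Lemma prod_affDes n (w : {perm (signed n)}) :
  \prod_(i in affDes w) 'X_i =
  'X_(inord 0 : 'I_n.+1) ^+ (0 < letterB w n.-1 + letterB w n)%R *
  \prod_(1 <= i < n.+1) 'X_(inord i : 'I_n.+1) ^+ (letterB w i < letterB w i.-1)%R
  :> {mpoly int[n.+1]}.
Proof.
rewrite big_mkcond big_ord_recl big_add1 big_mkord; congr (_ * _).
  rewrite inE /=; case: ifP => _; rewrite ?expr0 // expr1.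
  by congr 'X_(_); apply/val_inj; rewrite /= inordK.
apply: eq_bigr => i _; rewrite inE /=; case: ifP => _; rewrite ?expr0 // expr1.
by congr 'X_(_); apply/val_inj; rewrite /= inordK // ltnS.
Qed.

Lemma prod_affDes_signed_perm n (u : 'S_n) s : (2 <= n)%N ->
  \prod_(i in affDes (signed_perm (u, s))) 'X_i =
  \prod_(1 <= i < n.+1) sign_factor u i (sign_at s i) :> {mpoly int[n.+1]}.
Proof.
move=> n_gt1; rewrite prod_affDes.
pose t k : {mpoly int[n.+1]} := 'X_(inord k).
pose U := letterS u; pose e := sign_at s.
(* A descent at [i] is credited to the larger letter in absolute value: to letter [i] if negative
   ([neg i]), to letter [i.-1] if positive ([pos i.-1]). *)
pose neg i := t i ^+ (e i && (U i.-1 < U i)%N).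
pose pos i := t i.+1 ^+ (~~ e i && (U i.+1 < U i)%N).
have desE : \prod_(1 <= i < n.+1) t i ^+ (letterB (signed_perm (u, s)) i
      < letterB (signed_perm (u, s)) i.-1)%R =
    \prod_(1 <= i < n.+1) neg i * \prod_(1 <= i < n) pos i.
  transitivity (\prod_(1 <= i < n.+1) (neg i * pos i.-1)).
    apply: eq_big_nat => -[//|i] lein; rewrite !letterB_signed_perm.
    rewrite ltr_signed ?letterS_neq // expr_orb //=.
    by apply/negP => /andP[/andP[_ ?] /andP[_]]; rewrite ltnNge ltnW.
  rewrite big_split /= [X in _ * X]big_add1 /= [X in _ * X = _]big_ltn ?(ltnW n_gt1) //.
  (* The shifted product starts at [pos 0], which is 1 because [u_0 = 0] exceeds no letter. *)
  by rewrite [pos 0%N]/pos /= ltn0 andbF expr0 mul1r.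
rewrite desE !letterB_signed_perm addr_signed_gt0; last first.
  by rewrite letterS_neq // leqnn (ltnW n_gt1).
rewrite expr_orb; last first.
  by apply/negP => /andP[/andP[_ ?] /andP[_]]; rewrite ltnNge ltnW.
rewrite -/(t _) -/U -/e.
(* With [n = m.+2], the factors of the last two letters, which also carry [t 0], can be peeled
   off. *)
case: n n_gt1 u s @t @U @e @neg @pos {desE} => [|[|m]] // _ u s t U e neg pos.
rewrite [RHS]big_nat_recr // [X in _ = X * _]big_nat_recr //=.
rewrite [\prod_(1 <= i < m.+3) _]big_nat_recr //=.
rewrite [\prod_(1 <= i < m.+2) neg i]big_nat_recr //=.
rewrite [\prod_(1 <= i < m.+2) pos i]big_nat_recr //=.
have -> : \prod_(1 <= i < m.+1) sign_factor u i (e i) =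
    \prod_(1 <= i < m.+1) neg i * \prod_(1 <= i < m.+1) pos i.
  rewrite -big_split; apply: eq_big_nat => i /andP[_ ltim].
  rewrite /sign_factor ltim /= /neg /pos -/e -/U -/(t _) -/(t _).
  by case: (e i); rewrite /= expr0 ?mulr1 ?mul1r.
rewrite /sign_factor /= ltnn eqxx (ltnNge m.+2) leqnSn gtn_eqF //=.
rewrite -/(t _) -/(t _) -/e -/U /neg /pos -/(t _) /=.
(* If letter [n.-1] is larger and positive, it yields both [t 0] and [t n]; if letter [n] is larger,
   it yields [t n] when negative and [t 0] when positive. *)
by case: (e m.+1); case: (e m.+2); rewrite /= ?expr0 ?exprMn; ring.
Qed.

Theorem proposition5p8 (n : nat) (hn : (2 <= n)%N) :
  affEulerB n = \sum_(u : 'S_n) \prod_(1 <= i < n.+1) bfactor u i.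
Proof.
rewrite /affEulerB weylB_signed_perm big_imset /=; last first.
  by move=> p q _ _; apply: signed_perm_inj.
under eq_bigl do rewrite inE.
rewrite -(pair_bigA _ (fun u s =>
  \prod_(i in affDes (signed_perm (u, s))) 'X_i)) /=.
apply: eq_bigr => u _; under [RHS]eq_bigr do rewrite bfactorE.
(* Expanding the product of binomials picks one sign per position, that is, one function [s]. *)
rewrite [RHS]big_add1 big_mkord bigA_distr_bigA /=; apply: eq_bigr => s _.
rewrite prod_affDes_signed_perm // big_add1 big_mkord.
by apply: eq_bigr => k _; rewrite /sign_at /= valK.
Qed.
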